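(* Let $u\in U$ be the solution of $b(u,v)=l(v)$ for all $v\in V$. Let $\epsilon_0>0$, $0<\delta<1$, and consider the idealized adaptive algorithm (described in the context) with $N=\infty$ inner iterations, producing at each level $k\ge1$ meshes $\mathcal{T}_k^i$ and neural networks $u_{\theta^k}^i$, $i=1,2,\dots$. Assume that $u_{\theta^k}^i\to u_{\theta^k}$ as $i\to\infty$ (in $U$). Then $$\|u-u_{\theta^k}\|_U\le\frac{2}{\alpha}\,\delta^k\epsilon_0,$$ where $\alpha>0$ is the inf-sup constant of $b$, i.e. $\sup_{0\ne v\in V}\frac{b(w,v)}{\|v\|_V}\ge\alpha\|w\|_U$ for all $w\in U$.
   Context: Setting: $U$ and $V$ are (real) Hilbert spaces with norms $\|\cdot\|_U$, $\|\cdot\|_V$; $(\cdot,\cdot)_V$ is the inner product inducing $\|\cdot\|_V$. $b:U\times V\to\mathbb{R}$ is a bilinear form and $l\in V'$ a bounded linear functional such that: (1) there is $\mu>0$ with $b(w,v)\le\mu\|w\|_U\|v\|_V$ for all $w\in U$, $v\in V$; (2) there is $\alpha>0$ with $\sup_{0\ne v\in V}\frac{b(w,v)}{\|v\|_V}\ge\alpha\|w\|_U$ for all $w\in U$; (3) if $v\in V$ satisfies $b(w,v)=0$ for all $w\in U$, then $v=0$. Under these assumptions the problem ''find $u\in U$ with $b(u,v)=l(v)$ for all $v\in V$'' has a unique solution. For $w\in U$ the residual is $r(w,\cdot):=l(\cdot)-b(w,\cdot)\in V'$. The (continuous) Riesz representative $\phi(w)\in V$ is defined by $(\phi(w),v)_V=r(w,v)$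 for all $v\in V$. $U_{NN}=\{u_\theta:\theta\in\mathbb{R}^s\}\subset U$ is the set of functions representable by a fixed neural network architecture with parameter vector $\theta$; only $U_{NN}\subset U$ is assumed. With each mesh $\mathcal{T}$ is associated a finite-dimensional test space $V_{\mathcal{T}}\subset V$, and the discrete Riesz representative $\phi_{\mathcal{T}}(w)\in V_{\mathcal{T}}$ of $r(w,\cdot)$ with respect to $\mathcal{T}$ is defined by $(\phi_{\mathcal{T}}(w),v)_V=r(w,v)$ for all $v\in V_{\mathcal{T}}$. Idealized adaptive algorithm: given an initial mesh $\mathcal{T}_0$, $\epsilon_0>0$, $0<\delta<1$ and an initial network $u_{\theta^0}\in U_{NN}$, set $\mathcal{T}_1^0:=\mathcal{T}_0$, $u_{\theta^1}^0:=u_{\theta^0}$. For each level $k=1,2,\dots$ set $\epsilon_k:=\delta\,\epsilon_{k-1}$ and, for $i=1,2,\dots,N$: (ADAPT) using $u_{\theta^k}^{i-1}$, refine $\mathcal{T}_k^0$ to obtain a mesh $\mathcal{T}_k^i$ such that $\|\phi(u_{\theta^k}^{i-1})-\phi_{\mathcal{T}_k^i}(u_{\theta^k}^{i-1})\|_V\le\epsilon_k$; (LEARN) train $u_{\theta^k}^0$ over the mesh $\mathcal{T}_k^i$ to obtain a network $u_{\theta^k}^i\in U_{NN}$ such that $\|\phi_{\mathcal{T}_k^i}(u_{\theta^k}^i)\|_V\le\epsilon_k$. The next level starts from the terminal mesh and network of the current level ($\mathcal{T}_{k+1}^0:=\mathcal{T}_k^N$, $u_{\theta^{k+1}}^0:=u_{\theta^k}^N$).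 When $N=\infty$ the inner loop is infinite and the network of level $k$ is the limit $u_{\theta^k}$ of the sequence $(u_{\theta^k}^i)_{i}$. *)

(* Defs.v *)
From HB Require Import structures.
From mathcomp Require Import all_boot all_order all_algebra.
From mathcomp Require Import all_classical all_reals all_analysis.

Set Implicit Arguments.
Unset Strict Implicit.
Unset Printing Implicit Defensive.

Import Order.TTheory GRing.Theory Num.Theory.
Import numFieldNormedType.Exports.

Local Open Scope classical_set_scope.
Local Open Scope ring_scope.

(* Real Hilbert spaces: over the reals, [{dot H for idfun}] is the type of
   symmetric positive definite bilinear forms. *)
HB.mixin Record isHilbert (R : realType) H of CompleteNormedModule R H := {
  inner : {dot H for (@idfun R)};
  norm_inner : forall x : H, `|x| = Num.sqrt (inner x x)
}.

#[short(type="hilbertType")]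
HB.structure Definition Hilbert (R : realType) :=
  {H of CompleteNormedModule R H & isHilbert R H}.

Definition finite_dim_subspace (R : realType) (V : lmodType R) (S : set V) :=
  exists n (e : 'I_n -> V),
    S = [set \sum_(i < n) c i *: e i | c in [set: 'I_n -> R]].

Definition residual (R : realType) (U V : hilbertType R)
    (b : {bilinear U -> V -> R | *%R & *%R}) (l : {scalar V}) (w : U) (v : V)
    : R :=
  l v - b w v.

Definition is_riesz_representative (R : realType) (V : hilbertType R)
    (S : set V) (f : V -> R) (p : V) :=
  S p /\ forall v, S v -> inner p v = f v.

(* The default value 0 is never used when f is a bounded linear functional and
   S is [set: V] or a finite-dimensional subspace: by the Riesz theorem the
   representative then exists, and it is unique. *)
Definition riesz_representative (R : realType) (V : hilbertType R)
    (S : set V) (f : V -> R) : V :=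
  xget 0 [set p | is_riesz_representative S f p].

Definition riesz (R : realType) (U V : hilbertType R)
    (b : {bilinear U -> V -> R | *%R & *%R}) (l : {scalar V}) (w : U) : V :=
  riesz_representative [set: V] (residual b l w).

Definition discrete_riesz (R : realType) (U V : hilbertType R)
    (b : {bilinear U -> V -> R | *%R & *%R}) (l : {scalar V})
    (mesh : Type) (VT : mesh -> set V) (T : mesh) (w : U) : V :=
  riesz_representative (VT T) (residual b l w).

(* A run of the idealized adaptive algorithm with infinitely many inner
   iterations: levels k = 1, 2, ..., iterations i.+1 = 1, 2, ...; [T k i] and
   [un k i] are the mesh and the network of level k after i inner iterations,
   [NN theta] is the function represented by the network of parameter theta.
   The values at level 0 play no role.  A level with infinitely many
   iterations has no terminal mesh, so the initial meshes of the levels k > 1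
   are left free. *)
Record adaptive_run (R : realType) (U V : hilbertType R)
    (b : {bilinear U -> V -> R | *%R & *%R}) (l : {scalar V})
    (s : nat) (NN : 'rV[R]_s -> U)
    (mesh : Type) (refines : mesh -> mesh -> Prop) (VT : mesh -> set V)
    (T0 : mesh) (theta0 : 'rV[R]_s) (eps0 delta : R)
    (eps : nat -> R) (T : nat -> nat -> mesh) (un : nat -> nat -> U) : Prop := {
  run_mesh0 : T 1%N 0%N = T0;
  run_net0 : un 1%N 0%N = NN theta0;
  run_eps0 : eps 0%N = eps0;
  run_epsS : forall k, (0 < k)%N -> eps k = delta * eps k.-1;
  run_refine : forall k i, (0 < k)%N -> refines (T k 0%N) (T k i.+1);
  run_adapt : forall k i, (0 < k)%N ->
    `|riesz b l (un k i) - discrete_riesz b l VT (T k i.+1) (un k i)| <= eps k;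
  run_net : forall k i, (0 < k)%N -> range NN (un k i.+1);
  run_learn : forall k i, (0 < k)%N ->
    `|discrete_riesz b l VT (T k i.+1) (un k i.+1)| <= eps k;
  run_next : forall k uk, (0 < k)%N ->
    un k i @[i --> \oo] --> uk -> un k.+1 0%N = uk
}.

(* Main.v *)
(* The error is controlled by the residual: the inf-sup condition gives
   alpha |u - w| <= |phi(w)|.  Splitting phi(u^i) through the mesh T^(i+1) and
   using that the discrete representative is mu-Lipschitz in the network,
   (ADAPT) and (LEARN) give |phi(u^i)| <= 2 eps_k + mu |u^i - u^(i+1)|, and the
   last term vanishes in the limit. *)

Require Import Defs.
From HB Require Import structures.
From mathcomp Require Import all_boot all_order all_algebra.
From mathcomp Require Import all_classical all_reals all_analysis.
From mathcomp Require Import ring lra.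

Set Implicit Arguments.
Unset Strict Implicit.
Unset Printing Implicit Defensive.

Import Order.TTheory GRing.Theory Num.Theory.
Import numFieldNormedType.Exports.

Local Open Scope classical_set_scope.
Local Open Scope ring_scope.

(** Registers the residual as a linear form, so that the Riesz lemmas below apply to it directly. *)
HB.instance Definition _ (R : realType) (U V : hilbertType R)
    (b : {bilinear U -> V -> R | *%R & *%R}) (l : {scalar V}) (w : U) :=
  GRing.Linear.copy (residual b l w) (l \- b w).

Lemma innerC (R : realType) (V : hilbertType R) (x y : V) :
  inner x y = inner y x.
Proof. by rewrite hermC expr0 mul1r. Qed.

Lemma innerxx (R : realType) (V : hilbertType R) (x : V) :
  inner x x = `|x| ^+ 2.
Proof.
rewrite norm_inner sqr_sqrtr //.
by have [->|/neq0_dnorm_gt0/ltW//] := eqVneq x 0; rewrite linear0l.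
Qed.

Lemma inner_le_norm (R : realType) (V : hilbertType R) (x y : V) :
  inner x y <= `|x| * `|y|.
Proof.
have [->|x0] := eqVneq x 0; first by rewrite linear0l normr0 mul0r.
have [->|y0] := eqVneq y 0; first by rewrite linear0r normr0 mulr0.
have xy_gt0 : 0 < `|x| * `|y| by rewrite mulr_gt0 ?normr_gt0.
(* Cauchy-Schwarz: this square expands to [2 * |x| * |y| * (|x| * |y| - inner x y)], and the
   positive factor [|x| * |y|] cancels. *)
have : 0 <= inner (`|y| *: x - `|x| *: y) (`|y| *: x - `|x| *: y).
  by rewrite innerxx sqr_ge0.
rewrite linearBl !linearBr !linearZl_LR !linearZr_LR /= (innerC y x) !innerxx.
rewrite /GRing.scale /=.
move=> h; rewrite -subr_ge0 -(pmulr_rge0 _ xy_gt0). lra.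
Qed.

Lemma norm_inner_le (R : realType) (V : hilbertType R) (x y : V) :
  `|inner x y| <= `|x| * `|y|.
Proof.
by rewrite ler_norml inner_le_norm lerNl -linearNl -(normrN x) inner_le_norm.
Qed.

(* Near-minimizers of [|p|^2 - 2 f p] represent f approximately. *)
Lemma approx_riesz (R : realType) (V : hilbertType R) (f : {scalar V}) (C : R)
    (fC : forall v, `|f v| <= C * `|v|) (e : R) (e0 : 0 < e) :
  exists p, forall h, `|f h - inner p h| <= e * `|h|.
Proof.
pose J v : R := inner v v - 2 * f v.
(* [J v >= |v|^2 - 2 * C * |v| = (|v| - C)^2 - C^2]. *)
have Jlb : lbound (range J) (- C ^+ 2).
  move=> _ [v _ <-]; rewrite /J innerxx.
  have := fC v; have := ler_norm (f v); have := sqr_ge0 (`|v| - C); lra.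
have Jinf : has_inf (range J) by split; [exists (J 0), 0|exists (- C ^+ 2)].
have [_ [p _ <-] Jp] := inf_adherent (exprn_gt0 2 e0) Jinf.
exists p => h; have [->|h0] := eqVneq h 0.
  by rewrite !linear0 addr0 !normr0 mulr0.
have h2_gt0 : 0 < `|h| ^+ 2 by rewrite exprn_gt0 ?normr_gt0.
(* This [t] minimizes [J] on the line through [p] in direction [h]. The decrease [d^2 / |h|^2]
   cannot exceed [e^2], since [J p] is within [e^2] of the infimum. *)
set d := f h - inner p h; pose t := d / `|h| ^+ 2.
have JS : inf (range J) <= J (p + t *: h).
  by apply: ge_inf; [exists (- C ^+ 2)|exists (p + t *: h)].
have Jpt : J (p + t *: h) = J p - d ^+ 2 / `|h| ^+ 2.
  have fpt : f (p + t *: h) = f p + t * f h by rewrite linearD linearZ.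
  rewrite /J fpt linearDl !linearDr !linearZl_LR !linearZr_LR /=.
  rewrite (innerC h p) (innerxx h) /GRing.scale /= /t /d.
  by field; rewrite normr_eq0.
have : d ^+ 2 / `|h| ^+ 2 <= e ^+ 2 by lra.
rewrite ler_pdivrMr // -exprMn -real_normK ?num_real //.
by rewrite ler_pXn2r ?nnegrE ?mulr_ge0 // ltW.
Qed.

(** Approximate representatives with errors [1 / (n + 1)] form a Cauchy sequence; by completeness it
    converges, and its limit represents [f] exactly. *)
Lemma riesz_exists (R : realType) (V : hilbertType R) (f : {scalar V}) (C : R)
    (fC : forall v, `|f v| <= C * `|v|) :
  exists p, forall h, inner p h = f h.
Proof.
pose e n : R := n.+1%:R^-1.
have e_gt0 n : 0 < e n by rewrite invr_gt0.
have [p pP] := choice (fun n => approx_riesz fC (e_gt0 n)).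
(* Both approximation bounds are tested at [p m - p n] itself, and one factor of its norm is
   cancelled. *)
have p_near m n : `|p m - p n| <= e m + e n.
  have [->|d0] := eqVneq (p m - p n) 0; first by rewrite normr0 addr_ge0 ?ltW.
  have d_gt0 : 0 < `|p m - p n| by rewrite normr_gt0.
  rewrite -(ler_pM2r d_gt0) -expr2 -innerxx linearBl /=.
  have := pP m (p m - p n); have := pP n (p m - p n).
  rewrite !ler_norml => /andP[_ h1] /andP[h2 _]; lra.
have p_cvg : cvg (p n @[n --> \oo]).
  apply/cauchy_cvgP/cauchy_exP => eps eps_gt0.
  have eps2_gt0 : 0 < eps / 2 by lra.
  have [N _ eN] := near_infty_natSinv_lt (PosNum eps2_gt0).
  exists (p N), N => // n Nn; rewrite /= -ball_normE /=.
  have lt_e m : (N <= m)%N -> e m < eps / 2 by exact: eN.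
  have := p_near N n; have := lt_e N (leqnn N); have := lt_e n Nn; lra.
exists (lim (p n @[n --> \oo])) => h; set q := lim _.
apply/eqP; rewrite eq_sym -subr_eq0 -normr_le0.
have bound n : `|f h - inner q h| <= (e n + `|p n - q|) * `|h|.
  have -> : f h - inner q h = (f h - inner (p n) h) + inner (p n - q) h.
    by rewrite linearBl /=; ring.
  rewrite (le_trans (ler_normD _ _)) // mulrDl lerD //.
  exact: norm_inner_le.
have cvg0 : (e n + `|p n - q|) * `|h| @[n --> \oo] --> (0 : R).
  have -> : 0 = (0 + `|q - q|) * `|h| :> R by rewrite subrr normr0 addr0 mul0r.
  apply: cvgMl; apply: cvgD; first exact: cvg_harmonic.
  by apply: cvg_norm; apply: cvgB => //; exact: cvg_cst.
rewrite -(cvg_lim _ cvg0) //; apply: limr_ge; first by apply/cvg_ex; exists 0.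
by apply: nearW => n; exact: bound.
Qed.

(** Induction by one Gram-Schmidt step: the induction hypothesis for [inner (e ord0)] projects
    [e ord0] onto the span of the other vectors, and the one for [f] solves the problem there. A
    multiple of the orthogonal remainder [e'] then corrects the value at [e ord0]. *)
Lemma span_riesz (R : realType) (V : hilbertType R) (n : nat) (e : 'I_n -> V)
    (f : {scalar V}) :
  exists c : 'I_n -> R,
    forall i, inner (\sum_(j < n) c j *: e j) (e i) = f (e i).
Proof.
elim: n e f => [|n IH] e f; first by exists (fun=> 0) => -[].
pose e1 i := e (lift ord0 i); pose span c := \sum_(j < n) c j *: e1 j.
have ext (g g' : {scalar V}) : (forall i, g (e1 i) = g' (e1 i)) ->
    forall c, g (span c) = g' (span c).
  move=> gg' c; rewrite !linear_sum; apply: eq_bigr => i _.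
  by rewrite !linearZ /= gg'.
have [d dP] := IH e1 (inner (e ord0)).
have [c cP] := IH e1 f.
pose e' := e ord0 - span d; pose t := f e' / inner e' e'.
have e'1 i : inner e' (e1 i) = 0 by rewrite linearBl /= -/(span d) dP subrr.
(* The coordinates of [span c + t *: e'] in the family [e]. *)
pose g i := if unlift ord0 i is Some j then c j - t * d j else t.
exists g.
have tail_g : \sum_(i < n) g (lift ord0 i) *: e1 i = span c - t *: span d.
  rewrite scaler_sumr -sumrB; apply: eq_bigr => i _.
  by rewrite /g liftK scalerBl scalerA.
have -> : \sum_(j < n.+1) g j *: e j = span c + t *: e'.
  by rewrite big_ord_recl tail_g {1}/g unlift_none scalerBr [RHS]addrCA.
have p1 i : inner (span c + t *: e') (e1 i) = f (e1 i).
  by rewrite linearDl linearZl_LR /= e'1 mulr0 addr0 cP.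
(* If [e ord0] depends on the other vectors then [e' = 0] and both sides vanish, so dependent
   families are covered. *)
have te' : t * inner e' e' = f e'.
  have [e'0|/neq0_dnorm_gt0 e'_gt0] := eqVneq e' 0.
    by rewrite e'0 linear0l linear0 mulr0.
  by rewrite divfK // gt_eqF.
have pe' : inner (span c + t *: e') e' = f e'.
  rewrite linearDl linearZl_LR /= te' innerC.
  by rewrite linear_sum big1 ?add0r // => j _; rewrite linearZ /= e'1 mulr0.
move=> i; case: (unliftP ord0 i) => [j ->|->]; first exact: p1.
have -> : e ord0 = e' + span d by rewrite subrK.
by rewrite linearDr (linearD f) /= pe' (ext (inner (span c + t *: e')) f p1).
Qed.

Lemma finite_dim_subspaceB (R : realType) (V : lmodType R) (S : set V) :
  finite_dim_subspace S -> forall x y, S x -> S y -> S (x - y).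
Proof.
move=> [n [e ->]] _ _ [c _ <-] [d _ <-]; exists (c \- d) => //.
by rewrite -sumrB; apply: eq_bigr => i _; rewrite scalerBl.
Qed.

Lemma finite_dim_riesz_representative (R : realType) (V : hilbertType R)
    (S : set V) (f : {scalar V}) :
  finite_dim_subspace S ->
  is_riesz_representative S f (riesz_representative S f).
Proof.
move=> [n [e ->]]; apply: xgetPex; have [c cP] := span_riesz e f.
exists (\sum_(i < n) c i *: e i); split; first by exists c.
move=> _ [d _ <-]; rewrite !linear_sum; apply: eq_bigr => i _.
by rewrite !linearZ /= cP.
Qed.

Lemma setT_riesz_representative (R : realType) (V : hilbertType R)
    (f : {scalar V}) (C : R) (fC : forall v, `|f v| <= C * `|v|) :
  is_riesz_representative [set: V] f (riesz_representative [set: V] f).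
Proof.
by apply: xgetPex; have [p pP] := riesz_exists fC; exists p; split=> // v _.
Qed.

(** Testing both representations at [p - q], which lies in [S], gives [|p - q|^2 = f (p - q) - g (p
    - q) <= M * |p - q|]. *)
Lemma riesz_representative_dist (R : realType) (V : hilbertType R) (S : set V)
    (SB : forall x y, S x -> S y -> S (x - y)) (f g : V -> R) (p q : V)
    (M : R) (M_ge0 : 0 <= M) (fgM : forall v, f v - g v <= M * `|v|) :
  is_riesz_representative S f p -> is_riesz_representative S g q ->
  `|p - q| <= M.
Proof.
move=> [Sp pf] [Sq qg].
have [->|d0] := eqVneq (p - q) 0; first by rewrite normr0.
have d_gt0 : 0 < `|p - q| by rewrite normr_gt0.
rewrite -(ler_pM2r d_gt0) -expr2 -innerxx linearBl /=.
by rewrite pf ?qg; [exact: fgM|exact: SB..].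
Qed.

(* In the inf-sup condition the supremum is the real one: the continuity of b
   bounds the set of quotients, which is empty only if V = 0, where sup = 0. *)
Theorem proposition5p1 (R : realType) (U V : hilbertType R)
    (b : {bilinear U -> V -> R | *%R & *%R}) (l : {scalar V})
    (l_bounded : exists C : R, forall v : V, `|l v| <= C * `|v|)
    (mu : R) (mu_gt0 : 0 < mu)
    (b_continuous : forall (w : U) (v : V), b w v <= mu * `|w| * `|v|)
    (alpha : R) (alpha_gt0 : 0 < alpha)
    (b_inf_sup : forall w : U,
      sup [set b w v / `|v| | v in [set v : V | v != 0]] >= alpha * `|w|)
    (b_nondegenerate : forall v : V, (forall w : U, b w v = 0) -> v = 0)
    (u : U) (u_solution : forall v : V, b u v = l v)
    (s : nat) (NN : 'rV[R]_s -> U)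
    (mesh : Type) (refines : mesh -> mesh -> Prop) (VT : mesh -> set V)
    (VT_finite_dim : forall T : mesh, finite_dim_subspace (VT T))
    (T0 : mesh) (theta0 : 'rV[R]_s)
    (eps0 : R) (eps0_gt0 : 0 < eps0)
    (delta : R) (delta_gt0 : 0 < delta) (delta_lt1 : delta < 1)
    (eps : nat -> R) (T : nat -> nat -> mesh) (un : nat -> nat -> U)
    (run : adaptive_run b l NN refines VT T0 theta0 eps0 delta eps T un)
    (k : nat) (k_gt0 : (0 < k)%N)
    (uk : U) (un_cvg : un k i @[i --> \oo] --> uk) :
  `|u - uk| <= 2 / alpha * delta ^+ k * eps0.
Proof.
have [C lC] := l_bounded.
(* The one-sided continuity bound is applied to [w] and to [- w]. *)
have b_abs w v : `|b w v| <= mu * `|w| * `|v|.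
  by rewrite ler_norml b_continuous lerNl -linearNl -(normrN w) b_continuous.
have resC w v : `|residual b l w v| <= (C + mu * `|w|) * `|v|.
  by rewrite mulrDl (le_trans (ler_normB _ _)) ?lerD.
have eps_k : eps k = delta ^+ k * eps0.
  rewrite -(run_eps0 run); elim: (k) => [|j IH]; first by rewrite expr0 mul1r.
  by rewrite (run_epsS run) //= IH exprS mulrA.
(* Since [b u v = l v], each inf-sup quotient for [u - w] is [inner (riesz b l w) v / |v|], which
   Cauchy-Schwarz bounds. *)
have err w : alpha * `|u - w| <= `|riesz b l w|.
  have [_ phiP] := setT_riesz_representative (resC w).
  apply: le_trans (b_inf_sup _) _; set Q := (X in sup X).
  have ub : ubound Q `|riesz b l w|.
    move=> _ [v v0 <-]; rewrite ler_pdivrMr ?normr_gt0 //.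
    rewrite linearBl /= u_solution -/(residual b l w v) -phiP //.
    exact: inner_le_norm.
  have [->|/set0P ne] := eqVneq Q set0; first by rewrite sup0.
  exact: ge_sup.
(* The constant [mu] does not depend on the mesh [m]; this matters because the mesh changes with
   [i]. *)
have lip m w w' : `|discrete_riesz b l VT m w - discrete_riesz b l VT m w'|
    <= mu * `|w - w'|.
  have rep z := finite_dim_riesz_representative (residual b l z)
    (VT_finite_dim m).
  apply: riesz_representative_dist (rep w) (rep w').
  - exact: finite_dim_subspaceB.
  - by rewrite mulr_ge0 // ltW.
  - move=> v; rewrite /residual distrC.
    have -> : l v - b w v - (l v - b w' v) = b (w' - w) v.
      by rewrite linearBl /=; ring.
    exact: b_continuous.
(* On the common mesh [T k i.+1], (ADAPT) concerns the network [un k i] but (LEARN) concerns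
   [un k i.+1]; [lip] bridges this shift of index. *)
have step i : `|u - un k i| * alpha
    <= 2 * eps k + mu * `|un k i - un k i.+1|.
  rewrite mulrC; apply: le_trans (err _) _.
  have adapt := run_adapt run i k_gt0; have learn := run_learn run i k_gt0.
  move: adapt learn (lip (T k i.+1) (un k i) (un k i.+1)).
  set phi := riesz _ _ _; set phiT := discrete_riesz _ _ _ _ (un k i).
  set phiT' := discrete_riesz _ _ _ _ _ => h1 h2 h3.
  have -> : phi = (phi - phiT) + ((phiT - phiT') + phiT').
    by rewrite !subrK.
  have := ler_normD (phi - phiT) ((phiT - phiT') + phiT').
  have := ler_normD (phiT - phiT') phiT'.
  lra.
have lhs_cvg : `|u - un k i| * alpha @[i --> \oo] --> `|u - uk| * alpha.
  by apply: cvgMl; apply: cvg_norm; apply: cvgB => //; exact: cvg_cst.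
(* The shifted sequence has the same limit [uk], so the Lipschitz term tends to 0. *)
have rhs_cvg : 2 * eps k + mu * `|un k i - un k i.+1| @[i --> \oo]
    --> 2 * eps k + mu * `|uk - uk|.
  apply: cvgD; first exact: cvg_cst.
  apply: cvgMr; apply: cvg_norm; apply: cvgB => //.
  by rewrite (cvg_shiftS (un k)).
have : `|u - uk| * alpha <= 2 * eps k + mu * `|uk - uk|.
  exact: ler_cvg_to lhs_cvg rhs_cvg (nearW _ step).
rewrite subrr normr0 mulr0 addr0 -ler_pdivlMr // eps_k => /le_trans; apply.
by rewrite -!mulrA (mulrC alpha^-1) -!mulrA.
Qed.
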